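(* Let $E$ be a set with a filter $\mathfrak F$, let $F$ be a topological space, let $f:E\to F$ be a function and let $a\in F$. Then $f$ has $a$ as a limit along $\mathfrak F$ (i.e. $f^{-1}(V)\in\mathfrak F$ for every neighbourhood $V$ of $a$) if and only if the map of simplicial sets $\vec f:E^n\to F^n$, $(x_1,\dots,x_n)\mapsto(f(x_1),\dots,f(x_n))$, factors as $$E_{\mathfrak F\text{-}diag}\xrightarrow{\ \vec f_a\ }F_{top}[+1]\xrightarrow{[-1]}F_{top},\qquad \vec f_a:(x_1,\dots,x_n)\mapsto(a,f(x_1),\dots,f(x_n)),$$ with $\vec f_a$ continuous, i.e. a morphism in $\mathrm{sFilt}$.
   Context: A filter on a set $X$ is a collection of subsets of $X$, called neighbourhoods, closed under finite intersections (in particular containing $X$) and under passing to supersets; $\emptyset$ is allowed to be a neighbourhood and $X$ is allowed to be empty. A morphism of filters (a continuous map) is a function of the underlying sets such that the preimage of every neighbourhood is a neighbourhood. $\mathrm{Filt}$ is the category of filters. $\Delta$ is the category of finite linear orders $n_\le=\{0<\dots<n-1\}$, $n\ge 1$, and non-decreasing maps, and $\mathrm{sFilt}=\mathrm{Fun}(\Delta^{op},\mathrm{Filt})$ is the category of simplicial filters; a morphism in $\mathrm{sFilt}$ is a map of the underlying simplicial sets which is continuous at every level. Shift: $[+1]:\Delta\to\Delta$ adds a new minimal element (preserved by morphisms), and $X[+1]:=X\circ[+1]$, so $X[+1](n_\le)=X((n+1)_\le)$ as filters. The inclusions $n_\le\to (n+1)_\le$ omitting the new minimal element give a natural morphism $[-1]:X[+1]\to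 X$. For a topological space $X$, $X_{top}\in\mathrm{sFilt}$ has underlying simplicial set $n_\le\mapsto\mathrm{Hom}_{\mathrm{Sets}}(n,X)=X^n$ with filters: on $X^1$ the only neighbourhood is $X$; a subset of $X^2$ is a neighbourhood iff it contains $\bigcup_{x\in X}\{x\}\times U_x$ for some open $U_x\ni x$; for $n>2$ the filter on $X^n$ is the coarsest one making all maps $X^n\to X^2$, $(x_1,\dots,x_n)\mapsto(x_i,x_{i+1})$, $0<i<n$, continuous. $E_{\mathfrak F\text{-}diag}$ has underlying simplicial set $n_\le\mapsto E^n$, where a subset of $E^n$ is a neighbourhood iff it contains $\{(x,x,\dots,x):x\in\varepsilon\}$ for some $\varepsilon\in\mathfrak F$. *)

(* Defs.v *)
From HB Require Import structures.
From mathcomp Require Import all_boot all_order all_algebra.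
From mathcomp Require Import mathcomp_extra boolp classical_sets functions filter.
From mathcomp Require Import topology.

Set Implicit Arguments.
Unset Strict Implicit.
Unset Printing Implicit Defensive.

Local Open Scope classical_set_scope.

(* Every index is shifted by one: the number [n] stands for the object
   (n+1)_<= = {0 < ... < n} of Delta, so that only nonempty orders occur. *)

Record delta_hom (m n : nat) := DeltaHom {
  delta_fun :> 'I_m.+1 -> 'I_n.+1;
  delta_homo : {homo delta_fun : i j / (i <= j)%N}
}.

Lemma delta_hom_ext m n (p q : delta_hom m n) : p =1 q -> p = q.
Proof.
case: p q => p hp [q hq] /= /funext pq; rewrite pq in hp *.
by congr DeltaHom; exact: Prop_irrelevance.
Qed.

Definition delta_id n : delta_hom n n :=
  @DeltaHom n n id (fun _ _ ij => ij).

Definition delta_comp m n p (q : delta_hom n p) (r : delta_hom m n) :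
    delta_hom m p :=
  @DeltaHom m p (q \o r) (fun _ _ ij => delta_homo q (delta_homo r ij)).

(* The functor [+1]: the new minimal element is [ord0], and the old elements
   are embedded by [lift ord0]. *)
Definition delta_shift_fun m n (p : 'I_m.+1 -> 'I_n.+1) (i : 'I_m.+2) :
    'I_n.+2 :=
  if unlift ord0 i is Some j then lift ord0 (p j) else ord0.

Lemma delta_shift_homo m n (p : delta_hom m n) :
  {homo delta_shift_fun p : i j / (i <= j)%N}.
Proof.
move=> i j; rewrite /delta_shift_fun.
case: unliftP => [i'|] ->; case: unliftP => [j'|] -> //.
by rewrite !lift0 !ltnS; exact: delta_homo.
Qed.

Definition delta_shift m n (p : delta_hom m n) : delta_hom m.+1 n.+1 :=
  DeltaHom (delta_shift_homo p).

Lemma delta_shift_id n : delta_shift (delta_id n) = delta_id n.+1.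
Proof.
apply: delta_hom_ext => i /=; rewrite /delta_shift_fun.
by case: unliftP => [j|] ->.
Qed.

Lemma delta_shift_comp m n p (q : delta_hom n p) (r : delta_hom m n) :
  delta_shift (delta_comp q r) = delta_comp (delta_shift q) (delta_shift r).
Proof.
apply: delta_hom_ext => i /=; rewrite /delta_shift_fun.
by case: unliftP => [j|] _; rewrite ?liftK // unlift_none.
Qed.

Definition delta_skip n : delta_hom n n.+1.
Proof.
exists (lift ord0) => i j; by rewrite !lift0 ltnS.
Defined.

Record sSet := MkSSet {
  sset_obj :> nat -> Type;
  sset_map : forall m n, delta_hom m n -> sset_obj n -> sset_obj m;
  sset_map_id : forall n (x : sset_obj n), sset_map (delta_id n) x = x;
  sset_map_comp : forall m n p (q : delta_hom n p) (r : delta_hom m n)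
    (x : sset_obj p),
    sset_map (delta_comp q r) x = sset_map r (sset_map q x)
}.

Record sset_hom (X Y : sSet) := MkSSetHom {
  sset_fun :> forall n, X n -> Y n;
  sset_nat : forall m n (p : delta_hom m n) (x : X n),
    sset_fun (sset_map p x) = sset_map p (sset_fun x)
}.

Lemma sset_hom_ext (X Y : sSet) (g h : sset_hom X Y) :
  (forall n (x : X n), g n x = h n x) -> g = h.
Proof.
case: g h => g hg [h hh] /= gh.
have E : g = h by apply: functional_extensionality_dep => n; apply: funext.
rewrite E in hg *; by congr MkSSetHom; exact: Prop_irrelevance.
Qed.

Definition sset_comp (X Y Z : sSet) (h : sset_hom Y Z) (g : sset_hom X Y) :
  sset_hom X Z.
Proof.
exists (fun n => h n \o g n) => m n p x /=; by rewrite !sset_nat.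
Defined.

Definition sset_shift (X : sSet) : sSet.
Proof.
exists (fun n => X n.+1) (fun m n p => sset_map (delta_shift p)).
- by move=> n x; rewrite delta_shift_id sset_map_id.
- by move=> m n p q r x; rewrite delta_shift_comp sset_map_comp.
Defined.

Definition sset_drop (X : sSet) : sset_hom (sset_shift X) X.
Proof.
exists (fun n => sset_map (delta_skip n)) => m n p x /=.
rewrite -!sset_map_comp; congr sset_map; apply: delta_hom_ext => i /=.
by rewrite /delta_shift_fun liftK.
Defined.

(* The simplicial set (n+1)_<= |-> Hom_Sets({0, ..., n}, S) = S^(n+1). *)
Definition sset_pow (S : Type) : sSet :=
  @MkSSet (fun n => 'I_n.+1 -> S) (fun m n p x => x \o p)
    (fun _ _ => erefl) (fun _ _ _ _ _ _ => erefl).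

Definition sset_pow_map (S T : Type) (f : S -> T) :
    sset_hom (sset_pow S) (sset_pow T) :=
  @MkSSetHom (sset_pow S) (sset_pow T) (fun n x => f \o x)
    (fun _ _ _ _ => erefl).

(* A simplicial set with a filter on each of its levels. An object of sFilt
   is one whose structure maps are continuous, see [is_sFilt] below. That
   condition is kept apart because X_top, with the filters prescribed for it,
   satisfies it only for some spaces X (see [top_not_sFilt] below). It is not
   needed to speak of morphisms, which are the maps of simplicial sets that are
   continuous at every level; between objects satisfying [is_sFilt] these are
   exactly the morphisms of sFilt. *)
Record fsSet := MkFsSet {
  fs_sset :> sSet;
  fs_nbhs : forall n, set_system (fs_sset n);
  fs_filter : forall n, Filter (@fs_nbhs n)
}.
Arguments fs_nbhs : clear implicits.

Definition is_sFilt (X : fsSet) : Prop :=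
  forall m n (p : delta_hom m n) (W : set (X m)),
    fs_nbhs X m W -> fs_nbhs X n (sset_map p @^-1` W).

Record fs_hom (X Y : fsSet) := MkFsHom {
  fs_map :> sset_hom X Y;
  fs_cont : forall n (W : set (Y n)),
    fs_nbhs Y n W -> fs_nbhs X n (fs_map n @^-1` W)
}.

Definition fs_shift (X : fsSet) : fsSet :=
  @MkFsSet (sset_shift X) (fun n => fs_nbhs X n.+1)
    (fun n => fs_filter X n.+1).

Lemma fs_shift_is_sFilt (X : fsSet) : is_sFilt X -> is_sFilt (fs_shift X).
Proof. by move=> Xs m n p; exact: (Xs _ _ (delta_shift p)). Qed.

Section Top.
Variable T : topologicalType.

Definition top_nbhs2 : set_system ('I_2 -> T) :=
  filter_from [set U : T -> set T | forall x, open_nbhs x (U x)]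
    (fun U => [set p | U (p ord0) (p ord_max)]).

(* consec i x = (x_i, x_(i+1)) *)
Definition consec n (i : 'I_n) (x : 'I_n.+1 -> T) : 'I_2 -> T :=
  fun j => x (inord (i + j)).

(* The case [n] gives the filter on T^(n+1). *)
Definition top_nbhs (n : nat) : set_system ('I_n.+1 -> T) :=
  match n return set_system ('I_n.+1 -> T) with
  | 0 => [set setT]
  | 1 => top_nbhs2
  | n.+2 => smallest (@Filter ('I_n.+3 -> T))
      [set V | exists (i : 'I_n.+2) (W : set ('I_2 -> T)),
        top_nbhs2 W /\ V = consec i @^-1` W]
  end.
Arguments top_nbhs : clear implicits.

Lemma top_nbhs2_filter : Filter top_nbhs2.
Proof.
apply: filter_from_filter.
  by exists (fun=> setT) => x; exact: open_nbhsT.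
move=> U V Uo Vo; exists (fun x => U x `&` V x) => //.
by move=> x; exact: open_nbhsI.
Qed.

Lemma top_nbhs_filter n : Filter (top_nbhs n).
Proof.
case: n => [|[|n]] /=.
- exact: (filter_class (trivial_filter_on ('I_1 -> T))).
- exact: top_nbhs2_filter.
- exact: smallest_filter_filter.
Qed.

Definition fs_top : fsSet :=
  @MkFsSet (sset_pow T) top_nbhs top_nbhs_filter.

Lemma consec1 (i : 'I_1) (x : 'I_2 -> T) : consec i x = x.
Proof.
by apply/funext => j; rewrite /consec ord1 add0n inord_val.
Qed.

Lemma top_consec n (i : 'I_n) (W : set ('I_2 -> T)) :
  top_nbhs2 W -> top_nbhs n (consec i @^-1` W).
Proof.
case: n i => [[]//|[|n]] i hW /=.
  by rewrite (_ : _ @^-1` _ = W)//; apply/funext => x; rewrite /preimage/= consec1.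
by apply: sub_gen_smallest; exists i, W.
Qed.

Lemma top_drop_cont n (W : set ('I_n.+1 -> T)) :
  top_nbhs n W -> top_nbhs n.+1 (sset_drop (sset_pow T) n @^-1` W).
Proof.
have key m (i : 'I_m) (x : 'I_m.+2 -> T) :
    consec i (x \o delta_skip m) = consec (lift ord0 i) x.
  apply/funext => j; rewrite /consec /=; congr x; apply: val_inj.
  have ij : (i + j <= m)%N.
    have j1 : (j <= 1)%N := ltn_ord j.
    by rewrite (leq_trans (leq_add (leqnn i) j1))// addn1.
  by rewrite [LHS]lift0 inordK ?ltnS// [RHS]inordK /bump ?leq0n ?add1n ?addSn ?ltnS.
case: n W => [|[|n]] W.
- by move=> -> /=; rewrite preimage_setT; exact: (@filterT _ _ (top_nbhs_filter 1)).
- move=> hW; have := top_consec (lift ord0 (ord0 : 'I_1)) hW.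
  congr (top_nbhs _ _); apply/funext => x; rewrite /preimage /=.
  by rewrite -key consec1.
- set G := (X in X W -> _); set h := (X in X @^-1` _).
  have FG : Filter (fmap h (top_nbhs n.+3)).
    by apply: fmap_filter; exact: top_nbhs_filter.
  apply: (@smallest_sub _ _ _ (fmap h (top_nbhs n.+3)) FG) => V [i [V' [hV' ->]]].
  have := top_consec (lift ord0 i) hV'.
  congr (top_nbhs _ _); apply/funext => x; rewrite /preimage /h /=.
  by rewrite -key.
Qed.

(* The morphism [-1] : T_top[+1] -> T_top. *)
Definition fs_top_drop : fs_hom (fs_shift fs_top) fs_top :=
  @MkFsHom (fs_shift fs_top) fs_top (sset_drop (sset_pow T)) top_drop_cont.

End Top.

(* On [option nat], let the nonempty open sets be those that contain [None] and
   almost all [Some k]. Then (x_0, x_1, x_2) |-> (x_0, x_2) is not continuous. *)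
Definition cofin_open : set_system (option nat) :=
  [set U | U !=set0 -> U None /\ exists N, forall k, (N <= k)%N -> U (Some k)].

Lemma cofin_openT : cofin_open setT.
Proof. by move=> _; split=> //; exists 0. Qed.

Lemma cofin_openI : setI_closed cofin_open.
Proof.
move=> U V Uo Vo [x [Ux Vx]].
have [U0 [M UM]] := Uo (ex_intro _ x Ux).
have [V0 [N VN]] := Vo (ex_intro _ x Vx).
split=> //; exists (maxn M N) => k; rewrite geq_max => /andP[Mk Nk].
by split; [exact: UM|exact: VN].
Qed.

Lemma cofin_open_bigU (I : Type) (U : I -> set (option nat)) :
  (forall i, cofin_open (U i)) -> cofin_open (\bigcup_i U i).
Proof.
move=> Uo [x [i _ Ux]]; have [U0 [N UN]] := Uo i (ex_intro _ x Ux).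
by split; [exists i|exists N => k Nk; exists i => //; exact: UN].
Qed.

Definition cofin : Type := option nat.
HB.instance Definition _ := Choice.on cofin.
HB.instance Definition _ :=
  isOpenTopological.Build cofin cofin_openT cofin_openI cofin_open_bigU.

Lemma top_not_sFilt : ~ is_sFilt (fs_top cofin).
Proof.
have skip1 : {homo (fun i : 'I_2 => inord i.*2 : 'I_3) : i j / (i <= j)%N}.
  have lt3 (i : 'I_2) : (i.*2 < 3)%N by case: i => -[|[|]].
  by move=> i j ij; rewrite !inordK// leq_double.
pose U (x : cofin) : set cofin :=
  if x is Some k then [set~ Some k.+1] else setT.
have Uo x : open_nbhs x (U x).
  case: x => [k|]; last exact: open_nbhsT.
  split; last by move=> /= -[] /n_Sn.
  by move=> _; split=> //; exists k.+2 => l kl [] lk; rewrite lk ltnn in kl.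
have W2 : top_nbhs2 [set p | U (p ord0) (p ord_max)] by exists U.
pose chain (A : cofin -> set cofin) : set ('I_3 -> cofin) :=
  [set x | A (x (inord 0)) (x (inord 1)) /\ A (x (inord 1)) (x (inord 2))].
pose H := filter_from
  [set A : cofin -> set cofin | forall x, open_nbhs x (A x)] chain.
have FH : Filter H.
  apply: filter_from_filter; first by exists (fun=> setT) => x; exact: open_nbhsT.
  move=> A B Ao Bo; exists (fun x => A x `&` B x).
    by move=> x; exact: open_nbhsI.
  by move=> x [[? ?] [? ?]].
move=> /(_ 1%N 2%N (DeltaHom skip1) _ W2)/= skipW.
have := @smallest_sub _ _ _ H FH _ _ skipW.
case=> [V [i [W [[A Ao AW] ->]]]|A Ao Achain].
  exists A => // x [x01 x12]; apply: AW; rewrite /= /consec /= addn0.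
  by case: i => -[|[|//]] ? /=.
have [ANo ANN] := Ao None.
have [_ [N AN]] := ANo (ex_intro _ None ANN).
pose x : 'I_3 -> cofin := fun i =>
  if i == 0%N :> nat then Some N else if i == 1%N :> nat then None else Some N.+1.
have /Achain : chain A x.
  rewrite /chain /x /= !inordK//=; split; last by apply: AN.
  have [ASo ASN] := Ao (Some N).
  by case: (ASo (ex_intro _ (Some N) ASN)).
by rewrite /preimage /= /x !inordK//=; apply.
Qed.

Section Diag.
Variables (E : Type) (FF : filter_on E).

Definition diag_nbhs (n : nat) : set_system ('I_n.+1 -> E) :=
  filter_from (FF : set_system E) (fun e => (fun (x : E) (_ : 'I_n.+1) => x) @` e).
Arguments diag_nbhs : clear implicits.

Lemma diag_nbhs_filter n : Filter (diag_nbhs n).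
Proof.
apply: filter_from_filter; first by exists setT; exact: filterT.
move=> A B FA FB; exists (A `&` B); first exact: filterI.
by move=> _ [x [Ax Bx] <-]; split; exists x.
Qed.

Definition fs_diag : fsSet :=
  @MkFsSet (sset_pow E) diag_nbhs diag_nbhs_filter.

Lemma fs_diag_is_sFilt : is_sFilt fs_diag.
Proof.
move=> m n p W [e Fe eW]; exists e => // _ [x ex <-].
by apply: eW; exists x.
Qed.

End Diag.

(* The tuple (a, y_0, ..., y_(n-1)). *)
Definition tcons (T : Type) (n : nat) (a : T) (y : 'I_n -> T) : 'I_n.+1 -> T :=
  fun i => if unlift ord0 i is Some j then y j else a.

(* Main.v *)
Require Import Defs.
From mathcomp Require Import all_boot all_order all_algebra.
From mathcomp Require Import mathcomp_extra boolp classical_sets functions filter.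
From mathcomp Require Import topology.

Local Open Scope classical_set_scope.

(** A basic neighbourhood in [F^(n+2)] constrains only consecutive pairs. On the
    tuple [(a, y, ..., y)] these are [(a, y)] and the diagonal pairs [(y, y)];
    the latter lie in every neighbourhood of [F^2], so continuity of the map
    only says that [(a, f x)] is eventually in each neighbourhood of [F^2]. As
    [U_a] can be any open neighbourhood of [a], this is convergence to [a]. *)

Lemma tcons0 (T : Type) n (a : T) (y : 'I_n -> T) : tcons a y ord0 = a.
Proof. by rewrite /tcons unlift_none. Qed.

Lemma tcons_lift (T : Type) n (a : T) (y : 'I_n -> T) j :
  tcons a y (lift ord0 j) = y j.
Proof. by rewrite /tcons liftK. Qed.

(** Naturality of prepending [a]: [delta_shift p] fixes the new minimum, where [a] sits. *)
Lemma tcons_shift (T : Type) m n (p : delta_hom m n) (a : T) (y : 'I_n.+1 -> T) :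
  tcons a (y \o p) = tcons a y \o delta_shift p.
Proof.
apply/funext => i; rewrite /= /delta_shift_fun.
by case: (unliftP ord0 i) => [j|] ->; rewrite ?tcons_lift ?tcons0.
Qed.

Lemma tcons_cst (T : Type) n (a y : T) (i : 'I_n.+1) :
  tcons a (fun=> y) i = if i == 0%N :> nat then a else y.
Proof. by case: (unliftP ord0 i) => [j|] ->; rewrite ?tcons_lift ?tcons0. Qed.

Lemma top_nbhs2_refl (T : topologicalType) (W : set ('I_2 -> T)) (y : T) :
  @top_nbhs2 T W -> W (fun=> y).
Proof.
by case=> U Uo UW; apply: UW; have [_] := Uo y.
Qed.

Lemma top_nbhs2_point (T : topologicalType) (a : T) (V : set T) :
  nbhs a V -> @top_nbhs2 T [set p | p ord0 = a -> V (p ord_max)].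
Proof.
rewrite nbhsE => -[O Oa OV].
(* Only pairs starting at [a] are constrained, so every other point may take the whole space. *)
exists (fun x => if `[< x = a >] then O else setT).
  by move=> x; case: asboolP => [->//|_]; exact: open_nbhsT.
by move=> p /= + pa; case: asboolP => // _ /OV.
Qed.

(** Gives the three cases of [top_nbhs] one common minimality property; at level 0 there are no
    pairs and [[set setT]] is the least filter. *)
Lemma top_nbhs_sub (T : topologicalType) n (G : set_system ('I_n.+1 -> T)) :
  Filter G ->
  (forall (i : 'I_n) (W : set ('I_2 -> T)),
     @top_nbhs2 T W -> G (consec i @^-1` W)) ->
  @top_nbhs T n `<=` G.
Proof.
case: n G => [|[|n]] G FG GW V.
- by move=> ->; exact: filterT.
- move=> /(GW ord0); congr G; apply/funext => x.
  by rewrite /preimage /= consec1.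
- by apply: smallest_sub => _ [i [W [W2 ->]]]; exact: GW.
Qed.

Lemma consec_tcons_cst (T : topologicalType) n (a y : T) (i : 'I_n.+1) :
  consec i (tcons a (fun=> y)) =
  if i == 0%N :> nat then tcons a (fun=> y) else fun=> y.
Proof.
(* Since [i + j <= n + 1], [inord] never falls back to its default value; the entry is [a] only for
   [i = j = 0]. *)
apply/funext => j; rewrite /consec tcons_cst inordK; last first.
  have i_le : (i <= n)%N := ltn_ord i; have j_le : (j <= 1)%N := ltn_ord j.
  by rewrite ltnS (leq_trans (leq_add i_le j_le))// addn1.
rewrite addn_eq0; case: eqP => //= _.
by rewrite tcons_cst.
Qed.

Definition tcons_sset_hom (S T : Type) (f : S -> T) (a : T) :
  sset_hom (sset_pow S) (sset_shift (sset_pow T)) :=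
  @MkSSetHom (sset_pow S) (sset_shift (sset_pow T))
    (fun n x => tcons a (f \o x))
    (fun m n p x => tcons_shift T m n p a (f \o x)).

Lemma tcons_cont (E : Type) (FF : filter_on E) (F : topologicalType)
    (f : E -> F) (a : F) n (W : set ('I_n.+2 -> F)) :
  f @ FF --> a -> @top_nbhs F n.+1 W ->
  @diag_nbhs E FF n (tcons_sset_hom E F f a n @^-1` W).
Proof.
move=> fa; have FG : Filter (tcons_sset_hom E F f a n @ @diag_nbhs E FF n).
  by apply: fmap_filter; exact: diag_nbhs_filter.
apply: top_nbhs_sub FG _ W => i W W2.
have [U Uo UW] := W2.
(* Among the sets [U x], only [U a] is tested off the diagonal. *)
exists (f @^-1` U a); first by apply: fa; exact: open_nbhs_nbhs.
move=> _ [x Ux <-]; rewrite /preimage /= [_ \o _](_ : _ = fun=> f x)//.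
rewrite consec_tcons_cst; case: eqP => _; last exact: top_nbhs2_refl.
by apply: UW; rewrite /= !tcons_cst.
Qed.

Theorem mainTheorem7 (E : Type) (FF : filter_on E) (F : topologicalType)
    (f : E -> F) (a : F) :
  (f @ FF --> a) <->
  exists fa : fs_hom (fs_diag FF) (fs_shift (fs_top F)),
    (forall (n : nat) (x : 'I_n.+1 -> E), fa n x = tcons a (f \o x)) /\
    sset_comp (fs_top_drop F) fa = sset_pow_map f.
Proof.
split=> [fa|[fa [faE _]] V /top_nbhs2_point aV].
  exists (@MkFsHom (fs_diag FF) (fs_shift (fs_top F)) (tcons_sset_hom E F f a)
    (fun n W => tcons_cont E FF F f a n W fa)); split=> //.
  apply: sset_hom_ext => n x; apply/funext => i /=.
  exact: tcons_lift.
(* The lowest level suffices: after the shift its target is already $F^2$. *)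
have [e Fe eV] := @fs_cont _ _ fa 0%N _ aV.
apply: (filterS _ Fe) => x ex.
have := eV _ (ex_intro2 _ _ x ex erefl).
rewrite /preimage /= faE [_ \o _](_ : _ = fun=> f x)// !tcons_cst /=.
exact.
Qed.
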